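(* Let $\mu$ be a strictly increasing $C^2$ MOC satisfying the Osgood condition $\int_0^1\frac{dx}{\mu(x)}=\infty$, with $\lambda\colon\mathbb{R}\to\mathbb{R}$ and $\epsilon\colon\mathbb{R}\to\mathbb{R}$ given by $$\lambda(r)=r+\log\mu(e^{-r}),\qquad \epsilon(r)=\tfrac12\lambda'(r).$$ Assume that there is a neighborhood $\mathcal{N}$ of $r=\infty$ on which $\lambda(r)$ is strictly concave (or, equivalently, a neighborhood of the origin on which $A(x)=\frac{x\mu'(x)}{\mu(x)}$ is strictly decreasing). Then $\epsilon$ is invertible on $\mathcal{N}$, and calling that inverse $\eta$, and letting $$\alpha(\epsilon)=C_0\exp\{\lambda(\eta(\epsilon))-2\eta(\epsilon)\epsilon\},$$ we have $\theta(p)=p^{-1}\alpha(p^{-1})$ in a neighborhood of $p=\infty$ for some $C_0>0$. The function $\log\alpha$ is strictly convex in a neighborhood of the origin. If the following equivalent conditions hold: $$\lambda''(r)+(\lambda'(r))^2\ge0\quad\text{for all } r\in\mathbb{R},$$ $$x^2\mu''(x)-x\mu'(x)+\mu(x)\ge0\quad\text{for all } x>0,$$ $$\mu''(x)\ge\left(\frac{\mu(x)}{x}\right)'\quad\text{for all } x>0,$$ then $\log\theta(1/\epsilon)$ is convex (as a function of $\epsilon$) in a neighborhood of the origin, while $p\log\theta(p)$ is convex in a neighborhood of $\infty$.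
   Context: A modulus of continuity (MOC) is a continuous function $f\colon[0,\infty)\to[0,\infty)$ with $f(0)=0$; it is called $C^2$ if it is continuous on $[0,\infty)$ and $C^2$ on $(0,\infty)$. A function is strictly concave if its derivative is strictly decreasing; strict convexity is analogous. The function $\theta$ is related to $\mu$ by $$\mu(x)=\inf\{x^{1-2\epsilon}\alpha(\epsilon)\colon \epsilon\in(0,1/2]\},\qquad \alpha(\epsilon)=\epsilon^{-1}\theta(\epsilon^{-1}),$$ and the theorem concerns the inversion of this relation: starting with $\mu$, one seeks $\alpha$ and hence $\theta$. (In the application $\theta(p)$ is the $L^p$-norm of the vorticity of a solution to the 2D Euler equations and $\mu$ is the resulting MOC of the velocity field.)
   Formalization: The formal theorem additionally assumes that θ is continuous near p = ∞; without this the formula for θ fails (raising θ at isolated points tending to ∞ leaves μ unchanged), and the formula itself forces this continuity. *)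

(* Defs.v *)
From HB Require Import structures.
From mathcomp Require Import all_boot all_order all_algebra.
From mathcomp Require Import all_classical all_reals all_analysis.

Set Implicit Arguments.
Unset Strict Implicit.
Unset Printing Implicit Defensive.

Import Order.TTheory GRing.Theory Num.Theory.
Import numFieldNormedType.Exports.

Local Open Scope ring_scope.
Local Open Scope classical_set_scope.

(* In ring_scope these notations are otherwise those of polynomials. *)
Local Notation "f ^` ()" := (derive1 f) : ring_scope.
Local Notation "f ^` ( n )" := (derive1n n f) : ring_scope.

Section Definitions.
Variable R : realType.
Implicit Types (mu theta eta f : R -> R) (D : set R).

(* Moduli of continuity are total functions on R of which only the values on
   [0, +oo[ matter. *)
Definition modulus_of_continuity mu : Prop :=
  [/\ {within `[0, +oo[, continuous mu},
      (forall x, 0 <= x -> 0 <= mu x) & mu 0 = 0].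

Definition C2_pos mu : Prop := forall x, 0 < x ->
  [/\ derivable mu x 1, derivable mu^`() x 1 & {for x, continuous mu^`(2)}].

Definition osgood mu : Prop :=
  (\int[lebesgue_measure]_(x in `]0%R, 1%R]) ((mu x)^-1)%:E = +oo)%E.

(* Strict concavity (convexity) means, here, that the derivative exists and is
   strictly decreasing (increasing). *)
Definition strictly_concave_on D f : Prop :=
  {in D, forall x, derivable f x 1} /\
  {in D &, {homo f^`() : x y /~ x < y}}.

Definition strictly_convex_on D f : Prop :=
  {in D, forall x, derivable f x 1} /\
  {in D &, {homo f^`() : x y / x < y}}.

Definition lam mu (r : R) : R := r + ln (mu (expR (- r))).

Definition eps mu (r : R) : R := 2^-1 * (lam mu)^`() r.

Definition Afun mu (x : R) : R := x * mu^`() x / mu x.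

(* The real-valued inf is 0 on sets that are not bounded below; as mu > 0 on
   ]0, +oo[ for the mu considered, that default value is never used. *)
Definition related theta mu : Prop := forall x, 0 < x ->
  mu x = inf [set x `^ (1 - 2 * e) * (e^-1 * theta e^-1) |
                e in [set e | 0 < e <= 2^-1]].

Definition alpha mu eta (C0 e : R) : R :=
  C0 * expR (lam mu (eta e) - 2 * eta e * e).

Definition cond_lam mu : Prop := forall r,
  0 <= (lam mu)^`(2) r + ((lam mu)^`() r) ^+ 2.

Definition cond_mu mu : Prop := forall x, 0 < x ->
  0 <= x ^+ 2 * mu^`(2) x - x * mu^`() x + mu x.

Definition cond_quot mu : Prop := forall x, 0 < x ->
  (fun y => mu y / y)^`() x <= mu^`(2) x.

End Definitions.

(* Main.v *)
Require Import Defs.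
From HB Require Import structures.
From mathcomp Require Import all_boot all_order all_algebra.
From mathcomp Require Import all_classical all_reals all_analysis.
From mathcomp Require Import ring lra.

Import Order.TTheory GRing.Theory Num.Theory.
Import numFieldNormedType.Exports.

Local Open Scope ring_scope.
Local Open Scope classical_set_scope.

Set Implicit Arguments.
Unset Strict Implicit.
Unset Printing Implicit Defensive.

(** In the variable r = - ln x the relation between mu and theta becomes linear:
    with ell e = ln (e^-1 * theta e^-1) it says that
      lam r = inf over 0 < e <= 1/2 of (2 r e + ell e),
    a lower envelope of affine functions of r, i.e. a Legendre transform, and
    the theorem is the inversion of that transform near e = 0.

    Every affine function of the family lies above lam, so ell e is at least
    lam s - 2 s e for all s.  At a point r where lam is differentiable, an
    affine function of the family with slope away from lam' r = 2 eps r exceeds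
    lam r by a fixed amount, since it must stay above lam at r + h and r - h.
    The infimum is therefore approached only with e close to eps r, and
    continuity of ell at eps r gives ell (eps r) = lam r - 2 r (eps r)
    ([envelope_attained]).  This is the formula for theta, with C0 = 1, at each
    e that is a value of eps.

    All small e > 0 are values of eps: lam is nondecreasing, as an infimum of
    nondecreasing functions, and lam' is strictly decreasing near infinity, so
    eps is positive there; if lam' stayed above some c > 0, then 1 / mu would be
    O(x^(c-1)) at 0, hence integrable, against the Osgood condition
    ([osgood_small_slope]).  So the continuous function eps decreases to 0, and
    the intermediate value theorem applies ([legendre_inversion]).

    By the envelope principle the derivative of ln alpha at e is - 2 eta e
    ([is_derive_legendre]), and eta is decreasing: ln alpha is strictly convex.
    The derivative of ln (theta e^-1) = ln e + ln (alpha e) is e^-1 - 2 eta e;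
    along e = eps r it equals (eps r)^-1 - 2 r, whose derivative in r has the
    sign of - (lam'' + lam'^2).  Hence the convexity of ln (theta e^-1), and
    p ln (theta p) is the perspective of that function. *)

(** * Derivatives and convexity on the real line *)

Section RealCalculus.
Variable R : realType.
Implicit Types (f g df : R -> R).

Lemma is_derive_continuous f x l :
  is_derive x (1 : R) f l -> {for x, continuous f}.
Proof. by move=> [df _]; apply/differentiable_continuous/derivable1_diffP. Qed.

Lemma is_derive1E f x l : is_derive x (1 : R) f l -> derive1 f x = l.
Proof. by move=> d; rewrite derive1E derive_val. Qed.

Lemma derivable_is_derive1 f x :
  derivable f x 1 -> is_derive x (1 : R) f (derive1 f x).
Proof. by move=> d; rewrite derive1E; exact: derivableP. Qed.

(** The two increments share one step h, so that both can be weighed against a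
    single error term c * h. *)
Lemma is_derive_lt_increment f (x l : R) : is_derive x 1 f l ->
  forall c, 0 < c -> exists2 h, 0 < h &
    (l - c) * h < f (x + h) - f x /\ - (l + c) * h < f (x - h) - f x.
Proof.
move=> /is_derive1_caratheodory[g [fg cg gx]] c c0.
have /cvgrPdist_lt/(_ c c0) := cg.
move=> /nbhs_ballP[d /= d0 gd].
have d20 : 0 < d / 2 by lra.
have gp : `|g x - g (x + d / 2)| < c.
  by apply: gd; rewrite /ball/= opprD addNKr normrN gtr0_norm//; lra.
have gm : `|g x - g (x - d / 2)| < c.
  by apply: gd; rewrite /ball/= opprB addrC subrK gtr0_norm//; lra.
exists (d / 2) => //; rewrite !fg.
rewrite (_ : x + d / 2 - x = d / 2); last by ring.
rewrite (_ : x - d / 2 - x = - (d / 2)); last by ring.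
move: gp gm; rewrite gx !ltr_norml => /andP[? ?] /andP[? ?].
split; nra.
Qed.

Lemma derive_ge0_of_nondecreasing f (r l : R) :
  (forall x y, x <= y -> f x <= f y) ->
  is_derive r 1 f l -> 0 <= l.
Proof.
move=> nd dr; rewrite leNgt; apply/negP => l0.
have [h h0 [_ dn]] := is_derive_lt_increment dr (c := - l / 2) ltac:(lra).
have := nd (r - h) r ltac:(lra); nra.
Qed.

Lemma tangent_line_below (a b : R) f df :
  (forall x, a < x < b -> is_derive x 1 f (df x)) ->
  (forall x y, a < x -> x <= y -> y < b -> df x <= df y) ->
  forall z w, a < z < b -> a < w < b -> f z + df z * (w - z) <= f w.
Proof.
move=> fdf ndf z w /andP[az zb] /andP[aw wb].
have cf x y : a < x -> y < b -> {within `[x, y], continuous f}.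
  move=> ax yb; apply: continuous_in_subspaceT => u.
  rewrite inE/= in_itv/= => /andP[xu uy].
  by apply: is_derive_continuous; apply: fdf; lra.
have [zw|wz|->] := ltgtP z w; last by rewrite subrr mulr0 addr0.
- have D x : x \in `]z, w[%R -> is_derive x 1 f (df x).
    by rewrite in_itv/= => /andP[? ?]; apply: fdf; lra.
  have [c cI e] := MVT zw D (cf z w az wb).
  move: cI; rewrite in_itv/= => /andP[zc cw].
  have := ndf z c az (ltW zc) ltac:(lra).
  nra.
- have D x : x \in `]w, z[%R -> is_derive x 1 f (df x).
    by rewrite in_itv/= => /andP[? ?]; apply: fdf; lra.
  have [c cI e] := MVT wz D (cf w z aw zb).
  move: cI; rewrite in_itv/= => /andP[wc cz].
  have := ndf c z ltac:(lra) (ltW cz) zb.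
  nra.
Qed.

Lemma conv_realE (a b : R^o) (t : {i01 R}) :
  conv t a b = t%:num * a + (1 - t%:num) * b.
Proof. by []. Qed.

Lemma lt_convex_comb (s a x y : R) : 0 <= s <= 1 -> a < x -> a < y ->
  a < s * x + (1 - s) * y.
Proof.
move=> /andP[s0 s1] ax ay; have [->|sn0] := eqVneq s 0; first by lra.
have {}s0 : 0 < s by rewrite lt_def sn0.
nra.
Qed.

(** The value at a convex combination z lies on the tangent at z, and that
    tangent lies below the graph at both end points. *)
Lemma nondecreasing_derivative_convex (a b : R) f df :
  (forall x, a < x < b -> is_derive x 1 f (df x)) ->
  (forall x y, a < x -> x <= y -> y < b -> df x <= df y) ->
  convex_function (`]a, b[ : set R^o) f.
Proof.
move=> fdf ndf t x y; rewrite !inE/= !in_itv/= => xI yI.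
rewrite !conv_realE.
have t0 : 0 <= t%:num by [].
have t1 : t%:num <= 1 by [].
move: t0 t1; set s : R := t%:num => s0 s1.
set z := s * x + (1 - s) * y.
have zI : a < z < b.
  move: xI yI => /andP[ax xb] /andP[ay yb].
  rewrite /z lt_convex_comb ?s0 ?s1//= -ltrN2 opprD -!mulrN.
  by rewrite lt_convex_comb ?s0 ?s1// ltrN2.
have fx := tangent_line_below fdf ndf zI xI.
have fy := tangent_line_below fdf ndf zI yI.
have -> : f z = s * (f z + df z * (x - z)) + (1 - s) * (f z + df z * (y - z)).
  by rewrite /z; ring.
by apply: lerD; apply: ler_wpM2l => //; lra.
Qed.

Lemma convex_perspective (d : R) g : 0 < d ->
  convex_function (`]0, d[ : set R^o) g ->
  convex_function (`]d^-1, +oo[ : set R^o) (fun p => p * g p^-1).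
Proof.
move=> d0 cg t x y; rewrite !inE/= !in_itv/= !andbT => dx dy.
rewrite !conv_realE.
have di : 0 < d^-1 by rewrite invr_gt0.
have x0 : 0 < x by lra.
have y0 : 0 < y by lra.
have t0 : 0 <= t%:num by [].
have t1 : t%:num <= 1 by [].
set z := t%:num * x + (1 - t%:num) * y.
have z0 : 0 < z by rewrite lt_convex_comb ?t0 ?t1.
have s0 : 0 <= t%:num * x / z by rewrite divr_ge0 ?mulr_ge0// ltW.
have s1 : t%:num * x / z <= 1.
  by rewrite ler_pdivrMr// mul1r /z lerDl mulr_ge0 ?subr_ge0// ltW.
have inI u : d^-1 < u -> u^-1 \in (`]0, d[ : set R).
  move=> du; have u0 : 0 < u by lra.
  rewrite inE/= in_itv/= invr_gt0 u0/=.
  by rewrite -[ltRHS]invrK ltf_pV2// posrE.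
(* 1 / z is the convex combination of 1 / x and 1 / y with weights t x / z
   and (1 - t) y / z. *)
set s := t%:num * x / z in s0 s1.
have : g (s * x^-1 + (1 - s) * y^-1) <= s * g x^-1 + (1 - s) * g y^-1.
  exact: cg (Itv01 s0 s1) _ _ (inI _ dx) (inI _ dy).
have s_compl : 1 - s = (1 - t%:num) * y / z.
  rewrite /s; apply: (mulIf (lt0r_neq0 z0)).
  by rewrite mulrBl !divfK ?gt_eqF// mul1r /z addrAC subrr add0r.
have -> : s * x^-1 + (1 - s) * y^-1 = z^-1.
  by rewrite s_compl /s; field; rewrite ?gt_eqF.
move=> /(ler_wpM2l (ltW z0))/le_trans; apply.
rewrite le_eqVlt; apply/orP; left; apply/eqP.
by rewrite s_compl /s; field; rewrite gt_eqF.
Qed.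
End RealCalculus.

(** * The modulus in the logarithmic variable *)

Section LogarithmicVariable.
Variables (R : realType) (mu : R -> R).
Hypotheses (mu_gt0 : forall x, 0 < x -> 0 < mu x) (mu_C2 : C2_pos mu).

Lemma is_derive_Afun (x : R) : 0 < x ->
  is_derive x 1 (Afun mu)
    ((derive1 mu x + x * derive1n 2 mu x) / mu x
     - x * (derive1 mu x / mu x) ^+ 2).
Proof.
move=> x0.
have [/derivable_is_derive1 d1 /derivable_is_derive1 d2 _] := mu_C2 x0.
have mux0 : mu x != 0 by rewrite gt_eqF// mu_gt0.
have -> : Afun mu = (id * derive1 mu) * (fun y => (mu y)^-1) by apply/funext.
have d3 := is_deriveV mux0 d1.
by apply: is_derive_eq; rewrite fctE /GRing.scale/=; field.
Qed.

Lemma is_derive_lam (r : R) :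
  is_derive r 1 (lam mu) (1 - Afun mu (expR (- r))).
Proof.
have x0 := expR_gt0 (- r).
have [/derivable_is_derive1 d1 _ _] := mu_C2 x0.
have dN : is_derive r 1 (-%R : R -> R) (- 1) by exact: is_deriveNid.
have dx : is_derive r 1 (expR \o -%R) (expR (- r) * (- 1)).
  exact: is_derive1_comp.
have dm : is_derive r 1 (mu \o (expR \o -%R))
    (derive1 mu (expR (- r)) * (expR (- r) * (- 1))).
  exact: is_derive1_comp.
have dl : is_derive r 1 (@ln R \o (mu \o (expR \o -%R)))
    ((mu (expR (- r)))^-1 * (derive1 mu (expR (- r)) * (expR (- r) * (- 1)))).
  by apply: is_derive1_comp; apply: is_derive1_ln; exact: mu_gt0.
have -> : lam mu = id + (@ln R \o (mu \o (expR \o -%R))) by apply/funext.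
by apply: is_derive_eq; rewrite /Afun; ring.
Qed.

Lemma derive1_lam :
  derive1 (lam mu) = fun r => 1 - Afun mu (expR (- r)).
Proof. by apply/funext => r; apply: is_derive1E; exact: is_derive_lam. Qed.

Lemma is_derive_derive1_lam (r : R) :
  is_derive r 1 (derive1 (lam mu))
    (expR (- r) * derive1 (Afun mu) (expR (- r))).
Proof.
rewrite derive1_lam; have x0 := expR_gt0 (- r).
have dA := is_derive_Afun x0.
rewrite (is_derive1E dA); set l := _ - _ in dA *.
have dN : is_derive r 1 (-%R : R -> R) (- 1) by exact: is_deriveNid.
have dx : is_derive r 1 (expR \o -%R) (expR (- r) * (- 1)).
  exact: is_derive1_comp.
have dm : is_derive r 1 (Afun mu \o (expR \o -%R)) (l * (expR (- r) * (- 1))).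
  exact: is_derive1_comp.
have -> : (fun s => 1 - Afun mu (expR (- s))) =
    cst 1 - (Afun mu \o (expR \o -%R)).
  by apply/funext.
by apply: is_derive_eq; ring.
Qed.

(** With A for [Afun mu], lam' = 1 - A and
    lam'' = x A' = A + x^2 mu'' / mu - A^2: the squares of A cancel, so that
    the sum is linear in mu up to division by mu. *)
Lemma lam_riccati (r : R) :
  let x := expR (- r) in
  derive1n 2 (lam mu) r + (derive1 (lam mu) r) ^+ 2 =
  (x ^+ 2 * derive1n 2 mu x - x * derive1 mu x + mu x) / mu x.
Proof.
move=> x; have x0 : 0 < x := expR_gt0 (- r).
rewrite -[derive1n 2 _ _]/(derive1 (derive1 (lam mu)) r).
rewrite (is_derive1E (is_derive_derive1_lam r)) derive1_lam.
rewrite (is_derive1E (is_derive_Afun x0)) -/x /Afun.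
by field; rewrite gt_eqF// mu_gt0.
Qed.

Lemma cond_lam_mu : cond_lam mu <-> cond_mu mu.
Proof.
split=> h x.
  move=> x0; have := h (- ln x).
  rewrite lam_riccati opprK lnK ?posrE// => hx.
  by have := mulr_ge0 hx (ltW (mu_gt0 x0)); rewrite divfK// gt_eqF// mu_gt0.
have e0 := expR_gt0 (- x).
rewrite lam_riccati divr_ge0//; first exact: h.
exact/ltW/mu_gt0.
Qed.

Lemma cond_mu_quot : cond_mu mu <-> cond_quot mu.
Proof.
suff E x : 0 < x -> x ^+ 2 * derive1n 2 mu x - x * derive1 mu x + mu x =
    x ^+ 2 * (derive1n 2 mu x - derive1 (fun y => mu y / y) x).
  split=> h x x0; have := h x x0.
    by rewrite E// pmulr_rge0 ?exprn_gt0// subr_ge0.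
  by move=> ?; rewrite E// pmulr_rge0 ?exprn_gt0// subr_ge0.
move=> x0; have [/derivable_is_derive1 d1 _ _] := mu_C2 x0.
have xn0 : id x != 0 by rewrite gt_eqF.
have dV := is_deriveV xn0 (is_derive_id x (1 : R)).
have dq : is_derive x 1 (mu * (fun y => (id y)^-1))
  (derive1 mu x / x - mu x / x ^+ 2).
  apply: is_derive_eq; rewrite /= /GRing.scale /=.
  by field.
rewrite -[(fun y => mu y / y)]/(mu * (fun y => (id y)^-1)) (is_derive1E dq).
by field.
Qed.

(** lam' r = 1 - A (exp (- r)), and r |-> exp (- r) reverses the order. *)
Lemma strictly_concave_lam_Afun :
  (exists2 N : set R, (\forall r \near +oo, N r) &
     strictly_concave_on N (lam mu)) <->
  (exists2 d : R, 0 < d & {in `]0, d[ &, {homo Afun mu : x y /~ x < y}}).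
Proof.
have lamE := derive1_lam.
split=> [[N [M [_ NM]] [_ decr]]|[d d0 decr]].
  exists (expR (- M)); first exact: expR_gt0.
  have NE x : 0 < x -> x < expR (- M) -> - ln x \in (N : set R).
    move=> x0 xM; apply/mem_set/NM.
    by rewrite ltrNr -[ltRHS]expRK ltr_ln ?posrE ?expR_gt0.
  move=> x y; rewrite !inE/= !in_itv/= => /andP[x0 xM] /andP[y0 yM] yx.
  have := decr _ _ (NE y y0 yM) (NE x x0 xM).
  rewrite ltrN2 ltr_ln ?posrE// lamE !opprK !lnK ?posrE//.
  by move=> /(_ yx); rewrite ltrD2l ltrN2.
exists `]- ln d, +oo[%classic.
  exists (- ln d); split; first exact: num_real.
  by move=> x dx; rewrite /= in_itv/= dx.
split=> [r _|r s]; first by apply: ex_derive; exact: is_derive_lam.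
have inE' t : - ln d < t -> expR (- t) \in (`]0, d[ : set R).
  move=> dt; rewrite inE/= in_itv/= expR_gt0/=.
  by rewrite -[ltRHS](@lnK R) ?posrE// ltr_expR ltrNl.
rewrite !inE/= !in_itv/= !andbT => dr ds sr.
rewrite lamE ltrD2l ltrN2; apply: decr; [exact: inE'|exact: inE'|].
by rewrite ltr_expR ltrN2.
Qed.

Lemma is_derive_lam_eps (r : R) : is_derive r 1 (lam mu) (2 * eps mu r).
Proof.
rewrite /eps mulrA divff ?pnatr_eq0// mul1r.
by apply: derivable_is_derive1; apply: ex_derive; exact: is_derive_lam.
Qed.

Lemma is_derive_eps (r : R) :
  is_derive r 1 (eps mu) (2^-1 * derive1n 2 (lam mu) r).
Proof.
have dl : is_derive r 1 (derive1 (lam mu)) (derive1n 2 (lam mu) r).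
  apply: derivable_is_derive1; apply: ex_derive.
  exact: is_derive_derive1_lam.
have -> : eps mu = 2^-1 \*: derive1 (lam mu) by apply/funext.
by apply: is_derive_eq.
Qed.

End LogarithmicVariable.

(** * The Osgood condition forces a flat profile *)

Section Osgood.
Variables (R : realType) (mu : R -> R).
Hypothesis mu_gt0 : forall x, 0 < x -> 0 < mu x.

(** The integral over ]0, 1] is the limit of the integrals over
    [1 / (n + 2), 1], and each of these is at most G 1, for G the primitive of
    the bound that vanishes at 0. *)
Lemma osgood_power_bound (c K1 K2 : R) : 0 < c -> 0 <= K1 -> 0 <= K2 ->
  (forall x, 0 < x -> {for x, continuous mu}) ->
  (forall x, 0 < x <= 1 -> (mu x)^-1 <= K1 * x `^ (c - 1) + K2) ->
  ~ osgood mu.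
Proof.
move=> c0 K10 K20 cmu bnd.
pose a (n : nat) : R := n.+2%:R^-1.
have a0 n : 0 < a n by rewrite invr_gt0.
have a1 n : a n < 1 by rewrite invf_lt1// ltr1n.
pose G := fun x : R => K1 / c * x `^ c + K2 * x.
have dG (x : R) : 0 < x -> is_derive x 1 G (K1 * x `^ (c - 1) + K2).
  move=> x0; have dp := is_derive1_powR c x0.
  have -> : G = (K1 / c) \*: (fun y => powR y c) + K2 \*: id by apply/funext.
  by apply: is_derive_eq; rewrite /GRing.scale/=; field; rewrite gt_eqF.
have cf (x : R) : 0 < x ->
    {for x, continuous (fun x => K1 * x `^ (c - 1) + K2)}.
  move=> x0; have dp := is_derive1_powR (c - 1) x0.
  apply: cvgD; last exact: cvg_cst.
  by apply: cvgM; [exact: cvg_cst|exact: is_derive_continuous dp].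
have cI (f : R -> R) n : (forall x, 0 < x -> {for x, continuous f}) ->
    {within `[a n, 1], continuous f}.
  move=> h; apply: continuous_in_subspaceT => u.
  rewrite inE/= in_itv/= => /andP[au _]; apply: h.
  exact: lt_le_trans au.
have cmuV (x : R) : 0 < x -> {for x, continuous (fun x => (mu x)^-1)}.
  by move=> x0; apply: cvgV; [rewrite gt_eqF// mu_gt0|exact: cmu].
have mI (f : R -> R) n : (forall x, 0 < x -> {for x, continuous f}) ->
    lebesgue_measure.-integrable `[a n, 1] (EFin \o f).
  move=> h; apply: continuous_compact_integrable; first exact: segment_compact.
  exact: cI.
have piece n :
    (\int[lebesgue_measure]_(x in `[a n, 1%R]) ((mu x)^-1)%:E <= (G 1)%:E)%E.
  apply: (@le_trans _ _ (\int[lebesgue_measure]_(x in `[a n, 1%R])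
      (K1 * x `^ (c - 1) + K2)%:E)%E).
    apply: ge0_le_integral => //.
    - move=> x; rewrite /= in_itv/= => /andP[ax _].
      by rewrite lee_fin invr_ge0 ltW// mu_gt0// (lt_le_trans _ ax).
    - exact: measurable_int (mI _ n cmuV).
    - exact: measurable_int (mI _ n cf).
    - move=> x; rewrite /= in_itv/= => /andP[ax x1].
      rewrite lee_fin bnd// x1 andbT.
      exact: lt_le_trans ax.
  rewrite (@continuous_FTC2 _ _ G (a n) 1)//.
  - rewrite -EFinB lee_fin gerBl /G.
    by rewrite addr_ge0 ?mulr_ge0 ?invr_ge0 ?powR_ge0// ltW.
  - exact: cI.
  - split.
    + move=> x; rewrite in_itv/= => /andP[ax _]; apply: ex_derive.
      by apply: dG; apply: lt_trans ax.
    + by apply: cvg_at_right_filter; exact: is_derive_continuous (dG _ _).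
    + by apply: cvg_at_left_filter; exact: is_derive_continuous (dG _ _).
  - move=> x; rewrite in_itv/= => /andP[ax _]; apply: is_derive1E; apply: dG.
    exact: lt_trans ax.
have U : \bigcup_n `[a n, 1] = `]0, 1]%classic.
  apply/seteqP; split=> x /=.
    move=> [n _] /=; rewrite !in_itv/= => /andP[ax ->].
    by rewrite (lt_le_trans _ ax).
  rewrite in_itv/= => /andP[x0 x1]; have [n nx] := ltr_add_invr (y:=0) x0.
  exists n => //=; rewrite in_itv/= x1 andbT.
  rewrite add0r in nx; apply: ltW; apply: le_lt_trans nx.
  by rewrite /a lef_pV2 ?posrE// ler_nat.
rewrite /osgood -U => Hoo.
have cv :
  (\int[lebesgue_measure]_(x in `[a n, 1%R]) ((mu x)^-1)%:E)%E @[n --> \oo] -->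
  (\int[lebesgue_measure]_(x in \bigcup_n `[a n, 1%R]) ((mu x)^-1)%:E)%E.
  apply: ge0_nondecreasing_set_cvg_integral => //.
  - move=> m n mn; rewrite subsetEset => x /=.
    rewrite !in_itv/= => /andP[ax ->]; rewrite andbT; apply: le_trans ax.
    by rewrite /a lef_pV2 ?posrE// ler_nat.
  - by move=> n; exact: measurable_int (mI _ n cmuV).
  - move=> n x; rewrite /= in_itv/= => /andP[ax _].
    by rewrite lee_fin invr_ge0 ltW// mu_gt0// (lt_le_trans _ ax).
have : (\int[lebesgue_measure]_(x in \bigcup_n `[a n, 1%R]) ((mu x)^-1)%:E
    <= (G 1)%:E)%E.
  rewrite -(cvg_lim _ cv)//; apply: lime_le.
    by apply/cvg_ex; eexists; exact: cv.
  by apply: nearW => n; exact: piece.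
by rewrite Hoo leye_eq.
Qed.

(** A slope of at least c > 0 beyond M makes lam grow linearly, that is
    mu x >= K x^(1 - c) near 0; away from 0, monotonicity bounds 1 / mu. *)
Lemma osgood_small_slope :
  (forall x y, 0 <= x -> x < y -> mu x < mu y) -> C2_pos mu -> osgood mu ->
  forall M c : R, 0 < c -> exists2 r, M < r & derive1 (lam mu) r < c.
Proof.
move=> mu_incr mu_C2 osg M c c0.
have dlam r : derivable (lam mu) r 1 by apply: ex_derive; exact: is_derive_lam.
apply: contrapT => noslope.
have slope r : M < r -> c <= derive1 (lam mu) r.
  by move=> Mr; rewrite leNgt; apply/negP => h; apply: noslope; exists r.
have grow r : M + 1 <= r -> lam mu (M + 1) + c * (r - (M + 1)) <= lam mu r.
  rewrite le_eqVlt => /predU1P[<-|Mr]; first by rewrite subrr mulr0 addr0.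
  have D x : x \in `](M + 1), r[%R ->
      is_derive x 1 (lam mu) (derive1 (lam mu) x).
    by move=> _; exact: derivable_is_derive1.
  have [|s] := MVT Mr D; first by apply: derivable_within_continuous => ? _.
  rewrite in_itv/= => /andP[Ms sr] E.
  have := slope s ltac:(lra); nra.
pose B := lam mu (M + 1) - c * (M + 1).
pose x0 := expR (- (M + 1)).
have x00 : 0 < x0 := expR_gt0 _.
apply: (@osgood_power_bound c (expR (- B)) (mu x0)^-1) => //.
- by rewrite invr_ge0 ltW// mu_gt0.
- move=> x xp; have [d _ _] := mu_C2 x xp.
  exact: is_derive_continuous (derivable_is_derive1 d).
move=> x /andP[xp x1].
have [xx0|x0x] := leP x x0; last first.
  rewrite ler_wpDl ?mulr_ge0 ?expR_ge0 ?powR_ge0//.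
  by rewrite lef_pV2 ?posrE ?mu_gt0// ltW// mu_incr// ltW.
rewrite ler_wpDr ?invr_ge0 ?(ltW (mu_gt0 _))//.
have rM : M + 1 <= - ln x.
  by rewrite lerNr -[leRHS](@expRK R) ler_ln ?posrE.
have := grow _ rM; rewrite /lam opprK lnK ?posrE// => h.
rewrite /powR gt_eqF// -expRD -[leLHS]lnK ?posrE ?invr_gt0 ?mu_gt0//.
rewrite ler_expR lnV ?posrE ?mu_gt0//.
rewrite -/(lam mu (M + 1)) in h; rewrite /B; lra.
Qed.
End Osgood.

(** * Lower envelopes of affine functions *)

Section LowerEnvelope.
Variable R : realType.
Implicit Types (mu theta eta lmb ell : R -> R).

Definition log_weight theta (e : R) : R := ln (e^-1 * theta e^-1).

(** lmb r is the infimum of 2 r e + ell e over 0 < e <= 1/2, by its two defining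
    properties; this form makes no appeal to the default value of [inf]. *)
Definition lower_envelope lmb ell := forall r : R,
  (forall e, 0 < e <= 2^-1 -> lmb r <= 2 * r * e + ell e) /\
  (forall c, 0 < c ->
     exists2 e, 0 < e <= 2^-1 & 2 * r * e + ell e < lmb r + c).

(** Since mu is positive, the infimum that defines mu 1 is not the default value
    of [inf], so it bounds each of its terms below. *)
Lemma related_weight_gt0 theta mu e : (forall x, 0 < x -> 0 < mu x) ->
  related theta mu -> 0 < e <= 2^-1 -> 0 < e^-1 * theta e^-1.
Proof.
move=> mu0 rel eI.
have := mu0 1 ltr01; rewrite (rel 1 ltr01) => inf0.
set S := (S in inf S) in inf0.
have hS : has_inf S by apply: contrapT => /inf_out S0; rewrite S0 ltxx in inf0.
have : S (1 `^ (1 - 2 * e) * (e^-1 * theta e^-1)) by exists e.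
by move=> /(ge_inf hS.2)/(lt_le_trans inf0); rewrite powR1 mul1r.
Qed.

(** At x = exp (- r) the logarithm of x^(1 - 2 e) e^-1 theta(e^-1) is
    2 r e + log_weight theta e - r, and lam r is ln (mu x) + r. *)
Lemma related_lower_envelope theta mu : (forall x, 0 < x -> 0 < mu x) ->
  related theta mu -> lower_envelope (lam mu) (log_weight theta).
Proof.
move=> mu0 rel r; have x0 := expR_gt0 (- r).
have mux := mu0 _ x0.
have a0 e := @related_weight_gt0 theta mu e mu0 rel.
have infE := rel _ x0.
have lnT e : 0 < e <= 2^-1 ->
    ln (expR (- r) `^ (1 - 2 * e) * (e^-1 * theta e^-1)) =
    2 * r * e + log_weight theta e - r.
  move=> eI; rewrite lnM ?posrE; [|exact: powR_gt0|exact: a0].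
  by rewrite ln_powR expRK /log_weight; ring.
have T0 e : 0 < e <= 2^-1 ->
    0 < expR (- r) `^ (1 - 2 * e) * (e^-1 * theta e^-1).
  by move=> eI; apply: mulr_gt0; [exact: powR_gt0|exact: a0].
set S := (S in inf S) in infE.
have hS : has_inf S.
  by apply: contrapT => /inf_out S0; move: mux; rewrite infE S0 ltxx.
split=> [e eI|c c0].
  have : S (expR (- r) `^ (1 - 2 * e) * (e^-1 * theta e^-1)) by exists e.
  move=> /(ge_inf hS.2); rewrite -infE => h.
  have : ln (mu (expR (- r))) <= 2 * r * e + log_weight theta e - r.
    by rewrite -lnT// ler_ln ?posrE ?T0.
  by rewrite /lam; lra.
have d0 : 0 < mu (expR (- r)) * (expR c - 1).
  by rewrite mulr_gt0// subr_gt0 expR_gt1.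
have [_ [e eI <-]] := inf_adherent d0 hS.
rewrite -infE mulrBr mulr1 subrKC => h.
exists e => //.
have : 2 * r * e + log_weight theta e - r < ln (mu (expR (- r)) * expR c).
  by rewrite -lnT// ltr_ln ?posrE ?T0// mulr_gt0 ?expR_gt0.
by rewrite lnM ?posrE ?expR_gt0// expRK /lam; lra.
Qed.

Lemma envelope_nondecreasing lmb ell r s :
  lower_envelope lmb ell -> r <= s -> lmb r <= lmb s.
Proof.
move=> env rs; apply/ler_addgt0Pr => c c0.
have [e /andP[e0 e1] h] := (env s).2 _ c0.
have := (env r).1 e; rewrite e0 e1 => /(_ isT).
nra.
Qed.

(** If the infimum at r were not attained at half the slope e0 of lmb, the
    functions 2 r e + ell e would exceed lmb r by a fixed amount k for e near
    e0, by continuity, and by d * h for |e - e0| >= d, because at r + h (if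
    e <= e0 - d) or r - h (if e >= e0 + d) they still lie above lmb. *)
Lemma envelope_attained lmb ell (r e0 : R) : lower_envelope lmb ell ->
  0 < e0 <= 2^-1 -> is_derive r 1 lmb (2 * e0) -> {for e0, continuous ell} ->
  ell e0 = lmb r - 2 * r * e0.
Proof.
move=> env e0I dr ce.
apply/eqP; rewrite eq_le; apply/andP; split; last first.
  by rewrite lerBlDl; exact: (env r).1.
rewrite leNgt; apply/negP => gap.
pose k := (2 * r * e0 + ell e0 - lmb r) / 2.
have k0 : 0 < k by rewrite /k; lra.
have /cvgrPdist_lt/(_ k k0)/nbhs_ballP[d /= d0 near_e0] :
    (fun e => 2 * r * e + ell e) e @[e --> e0] --> 2 * r * e0 + ell e0.
  by apply: cvgD => //; apply: cvgM; [exact: cvg_cst|exact: cvg_id].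
have [h h0 [up dn]] := is_derive_lt_increment dr d0.
have dh : 0 < d * h by rewrite mulr_gt0.
have kdh : 0 < Num.min k (d * h) by rewrite lt_min k0 dh.
have [e eI le_e] := (env r).2 _ kdh.
have {le_e} [lek ledh] :
    2 * r * e + ell e < lmb r + k /\ 2 * r * e + ell e < lmb r + d * h.
  by split; apply: lt_le_trans le_e _; rewrite lerD2l ge_min lexx ?orbT.
have [|far] := ltP `|e0 - e| d.
  move=> /near_e0; rewrite ltr_norml /k => /andP[? ?].
  by rewrite /k in lek; lra.
have le1 := (env (r + h)).1 e eI.
have le2 := (env (r - h)).1 e eI.
by move: far; rewrite ler_normr => /orP[far|far]; nra.
Qed.

(** The envelope principle: the competitors eta e0 at e and eta e at e0 squeeze
    ell e - ell e0 between - 2 (eta e0) (e - e0) and - 2 (eta e) (e - e0), so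
    the difference quotient follows eta as e tends to e0. *)
Lemma is_derive_legendre ell lmb eta (e0 : R) :
  {for e0, continuous eta} ->
  (\forall e \near e0, ell e = lmb (eta e) - 2 * eta e * e) ->
  (\forall e \near e0, forall s, lmb s - 2 * s * e <= ell e) ->
  is_derive e0 1 ell (- 2 * eta e0).
Proof.
move=> ceta att ub.
have att0 := nbhs_singleton att.
have ub0 := nbhs_singleton ub.
apply/is_derive1_caratheodory.
pose g e := if e == e0 then - 2 * eta e0 else (ell e - ell e0) / (e - e0).
exists g; split; last by rewrite /g eqxx.
  move=> e; rewrite /g; have [->|ne] := eqVneq e e0.
    by rewrite !subrr mulr0.
  by rewrite divfK// subr_eq0.
apply/cvgrPdist_le => /= c c0.
have c20 : 0 < c / 2 by lra.
have ceta' := (cvgrPdist_le _ _).1 ceta _ c20.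
near=> e.
have atte : ell e = lmb (eta e) - 2 * eta e * e by near: e.
have ube : forall s, lmb s - 2 * s * e <= ell e by near: e.
have ce : `|eta e0 - eta e| <= c / 2 by near: e; exact: ceta'.
rewrite /g eqxx; have [_|ne] := eqVneq e e0; first by rewrite subrr normr0 ltW.
have {}ube := ube (eta e0); have {}ub0 := ub0 (eta e).
move: ce; rewrite !ler_norml => /andP[? ?].
have [lt|gt|E] := ltgtP e e0; last by rewrite E eqxx in ne.
- have h : e - e0 < 0 by rewrite subr_lt0.
  rewrite -(ler_nM2r h) -[X in _ && X](ler_nM2r h) mulrBl divfK ?subr_eq0//.
  by apply/andP; split; nra.
- have h : 0 < e - e0 by rewrite subr_gt0.
  rewrite -(ler_pM2r h) -[X in _ && X](ler_pM2r h) mulrBl divfK ?subr_eq0//.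
  by apply/andP; split; nra.
Unshelve. all: end_near. Qed.

End LowerEnvelope.

(** * Inversion near infinity *)

Section Inversion.
Variables (R : realType) (mu theta eta : R -> R) (N : set R) (M P : R).
Hypotheses (mu_gt0 : forall x, 0 < x -> 0 < mu x) (mu_C2 : C2_pos mu)
  (mu_incr : forall x y, 0 <= x -> x < y -> mu x < mu y) (mu_osgood : osgood mu)
  (NM : forall r, M < r -> N r) (conc : strictly_concave_on N (lam mu))
  (ctheta : forall p, P < p -> {for p, continuous theta})
  (rel : related theta mu) (etaK : {in N, cancel (eps mu) eta}).

Lemma eps_decr r s : M < r -> r < s -> eps mu s < eps mu r.
Proof.
move=> Mr rs; rewrite /eps ltr_pM2l ?invr_gt0 ?ltr0n//.
by apply: conc.2 => //; apply/mem_set/NM => //; exact: lt_trans rs.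
Qed.

Lemma eps_gt0 r : M < r -> 0 < eps mu r.
Proof.
move=> Mr; have rr1 : r < r + 1 by rewrite ltrDl.
apply: le_lt_trans (eps_decr Mr rr1).
have dl := is_derive_lam_eps mu_gt0 mu_C2 (r + 1).
have : 0 <= 2 * eps mu (r + 1).
  apply: derive_ge0_of_nondecreasing dl => x y.
  exact: envelope_nondecreasing (related_lower_envelope mu_gt0 rel).
by rewrite pmulr_rge0.
Qed.

Lemma eps_surj e : 0 < e < eps mu (M + 1) -> exists2 r, M < r & eps mu r = e.
Proof.
move=> /andP[e0 eM].
have e20 : 0 < 2 * e by rewrite mulr_gt0.
have [s Ms se] := osgood_small_slope mu_gt0 mu_incr mu_C2 mu_osgood (M + 1) e20.
have {}se : eps mu s < e by rewrite /eps; lra.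
have [||r] := @IVT R (eps mu) (M + 1) s e (ltW Ms).
- apply: derivable_within_continuous => x _; apply: ex_derive.
  exact: is_derive_eps.
- by rewrite ge_min le_max (ltW se) (ltW eM) orbT.
rewrite in_itv/= => /andP[Mr _] <-; exists r => //.
by apply: lt_le_trans Mr; rewrite ltrDl.
Qed.

(** A left inverse of a continuous function of one real variable, near a point,
    is continuous at the image of that point. *)
Lemma eta_continuous r : M < r -> {for eps mu r, continuous eta}.
Proof.
move=> Mr.
have epsK : {near r, cancel (eps mu) eta}.
  have := lt_nbhsr Mr; apply: filterS => x Mx.
  by apply: etaK; apply/mem_set/NM.
have ceps : \forall x \near r, {for x, continuous (eps mu)}.
  by near=> x; exact: is_derive_continuous (is_derive_eps mu_gt0 mu_C2 x).
exact: nbhs_singleton (near_can_continuous epsK ceps).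
Unshelve. all: end_near. Qed.

(** The interval ]0, d[ is chosen inside the domain ]0, 1/2] of the weights,
    inside the range of eps, and so small that theta is continuous at 1 / e. *)
Lemma legendre_inversion : exists2 d, 0 < d <= 2^-1 & forall e, 0 < e < d ->
  [/\ M < eta e, eps mu (eta e) = e, {for e, continuous eta},
    log_weight theta e = lam mu (eta e) - 2 * eta e * e &
    forall s, lam mu s - 2 * s * e <= log_weight theta e].
Proof.
have env := related_lower_envelope mu_gt0 rel.
have P0 : 0 < Num.max P 1 by rewrite lt_max ltr01 orbT.
have eM : 0 < eps mu (M + 1) by apply: eps_gt0; rewrite ltrDl.
exists (Num.min 2^-1 (Num.min (Num.max P 1)^-1 (eps mu (M + 1)))).
  by rewrite !lt_min ge_min lexx !invr_gt0 P0 eM ltr0n.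
move=> e /andP[e0]; rewrite !lt_min => /and3P[e2 eP ee].
have eI : 0 < e <= 2^-1 by rewrite e0 ltW.
have [r Mr re] := eps_surj (e := e) ltac:(by rewrite e0 ee).
have etae : eta e = r by rewrite -re etaK//; apply/mem_set/NM.
have Pe : P < e^-1.
  have : Num.max P 1 < e^-1 by rewrite -[ltLHS]invrK ltf_pV2 ?posrE ?invr_gt0.
  by rewrite gt_max => /andP[].
have cw : {for e, continuous (log_weight theta)}.
  have cV : {for e, continuous (fun x : R => x^-1)}.
    by apply: cvgV; [rewrite gt_eqF|exact: cvg_id].
  have ct : {for e, continuous (fun x : R => theta x^-1)}.
    exact: (continuous_comp cV (ctheta Pe)).
  have cf : {for e, continuous (fun x : R => x^-1 * theta x^-1)}.
    exact: cvgM cV ct.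
  have cl := continuous_ln (related_weight_gt0 mu_gt0 rel eI).
  exact: (continuous_comp cf cl).
split; rewrite ?etae//.
- by rewrite -re; exact: eta_continuous.
- apply: (envelope_attained env eI) => //.
  by rewrite -re; exact: is_derive_lam_eps.
- by move=> s; rewrite lerBlDl; exact: (env s).1.
Qed.

End Inversion.

(** * Formula and convexity *)

Section Consequences.
Variables (R : realType) (mu theta eta : R -> R) (M d : R).
Hypotheses (mu_gt0 : forall x, 0 < x -> 0 < mu x) (mu_C2 : C2_pos mu)
  (rel : related theta mu) (dI : 0 < d <= 2^-1)
  (eps_pos : forall r, M < r -> 0 < eps mu r)
  (eps_dec : forall r s, M < r -> r < s -> eps mu s < eps mu r)
  (inv : forall e, 0 < e < d ->
    [/\ M < eta e, eps mu (eta e) = e, {for e, continuous eta},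
      log_weight theta e = lam mu (eta e) - 2 * eta e * e &
      forall s, lam mu s - 2 * s * e <= log_weight theta e]).

Lemma near_interval (e : R) : 0 < e < d -> \forall x \near e, 0 < x < d.
Proof.
move=> /andP[e0 ed]; near=> x; apply/andP; split; near: x.
  exact: lt_nbhsr.
exact: lt_nbhsl.
Unshelve. all: by end_near. Qed.

Lemma eta_decr (x y : R) : 0 < x < d -> 0 < y < d -> x < y -> eta y < eta x.
Proof.
move=> xI yI; have [Mx ex _ _ _] := inv xI; have [My ey _ _ _] := inv yI.
rewrite -{1}ex -{1}ey => lt; rewrite ltNge le_eqVlt.
apply/negP => /predU1P[E|gt].
  by rewrite E ltxx in lt.
by have := lt_trans lt (eps_dec Mx gt); rewrite ltxx.
Qed.

Lemma is_derive_log_alpha (e : R) : 0 < e < d ->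
  is_derive e 1 (fun e => lam mu (eta e) - 2 * eta e * e) (- 2 * eta e).
Proof.
move=> eI; have [_ _ ce _ _] := inv eI.
apply: (is_derive_legendre ce); apply: filterS (near_interval eI) => x xI //.
by have [_ _ _ <- ub] := inv xI.
Qed.

Lemma log_alphaE (C e : R) : 0 < C ->
  ln (alpha mu eta C e) = ln C + (lam mu (eta e) - 2 * eta e * e).
Proof. by move=> C0; rewrite /alpha lnM ?posrE ?expR_gt0// expRK. Qed.

Lemma log_alpha_strictly_convex :
  strictly_convex_on `]0, d[ (fun e => ln (alpha mu eta 1 e)).
Proof.
have -> : (fun e => ln (alpha mu eta 1 e)) =
    (fun e => lam mu (eta e) - 2 * eta e * e).
  by apply/funext => e; rewrite log_alphaE// ln1 add0r.
split=> [x|x y]; rewrite !inE/= !in_itv/= => xI.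
  by apply: ex_derive; exact: is_derive_log_alpha.
move=> yI xy; rewrite (is_derive1E (is_derive_log_alpha xI)).
rewrite (is_derive1E (is_derive_log_alpha yI)).
by have := eta_decr xI yI xy; lra.
Qed.

Lemma theta_alpha (p : R) : d^-1 < p -> theta p = p^-1 * alpha mu eta 1 p^-1.
Proof.
have /andP[d0 d2] := dI; move=> dp.
have p0 : 0 < p by apply: lt_trans dp; rewrite invr_gt0.
have eI : 0 < p^-1 < d.
  by rewrite invr_gt0 p0/= -[ltRHS]invrK ltf_pV2 ?posrE ?invr_gt0.
have wI : 0 < p^-1 <= 2^-1 by have /andP[-> /ltW/le_trans] := eI; apply.
have [_ _ _ E _] := inv eI; have := related_weight_gt0 mu_gt0 rel wI.
rewrite /alpha mul1r -E /log_weight invrK => w0.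
by rewrite lnK ?posrE// mulKf ?gt_eqF ?invr_gt0.
Qed.

Lemma is_derive_log_theta (e : R) : 0 < e < d ->
  is_derive e 1 (fun e => ln (theta e^-1)) (e^-1 - 2 * eta e).
Proof.
move=> eI; have /andP[e0 _] := eI.
have dl := is_derive1_ln e0; have dw := is_derive_log_alpha eI.
apply: (@near_eq_is_derive _ _ _
  (@ln R + (fun e => lam mu (eta e) - 2 * eta e * e))).
  apply: filterS (near_interval eI) => x xI; have /andP[x0 xd] := xI.
  have /andP[d0 d2] := dI.
  have wI : 0 < x <= 2^-1 by rewrite x0 (le_trans (ltW xd)).
  have w0 := related_weight_gt0 mu_gt0 rel wI.
  have [_ _ _ E _] := inv xI.
  by rewrite fctE -E /log_weight -lnM ?posrE// mulrA divff ?mul1r// gt_eqF.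
by apply: is_derive_eq; ring.
Qed.

(** The derivative of 1 / eps - 2 r is - (lam'' + lam'^2) / (2 eps^2). *)
Lemma recip_eps_decr r s : cond_lam mu -> M < r -> r <= s ->
  (eps mu s)^-1 - 2 * s <= (eps mu r)^-1 - 2 * r.
Proof.
move=> cl Mr rs.
have D x : r <= x -> is_derive x 1 (fun x => (eps mu x)^-1 - 2 * x)
    (- (eps mu x) ^- 2 * (2^-1 * derive1n 2 (lam mu) x) - 2).
  move=> rx; have e0 : eps mu x != 0.
    by rewrite gt_eqF// eps_pos// (lt_le_trans Mr).
  have dV := is_deriveV e0 (is_derive_eps mu_gt0 mu_C2 x).
  have -> : (fun x => (eps mu x)^-1 - 2 * x) =
      (fun x => (eps mu x)^-1) - 2 \*: id by apply/funext.
  by apply: is_derive_eq; rewrite /GRing.scale/=; ring.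
apply: (ler0_derive1_nincry (a := r)
  (f := fun x => (eps mu x)^-1 - 2 * x)) => //.
- by move=> x; rewrite in_itv/= andbT => /ltW/D[].
- move=> x; rewrite in_itv/= andbT => rx; rewrite (is_derive1E (D x (ltW rx))).
  have e0 : 0 < eps mu x by rewrite eps_pos// (lt_trans Mr).
  have := cl x; have -> : derive1 (lam mu) x = 2 * eps mu x.
    by rewrite /eps; field.
  set q := derive1n 2 _ x => h.
  have -> : - (eps mu x) ^- 2 * (2^-1 * q) - 2 =
      - (2^-1 * (q + (2 * eps mu x) ^+ 2) / eps mu x ^+ 2).
    by field; rewrite gt_eqF.
  by rewrite oppr_le0 divr_ge0 ?sqr_ge0// mulr_ge0 ?invr_ge0.
- by apply: derivable_within_continuous => x; rewrite in_itv/= andbT => /D[].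
Qed.

Lemma log_theta_convex : cond_lam mu ->
  convex_function (`]0, d[ : set R^o) (fun e => ln (theta e^-1)).
Proof.
move=> cl.
apply: nondecreasing_derivative_convex is_derive_log_theta _ => x y x0.
rewrite le_eqVlt => /predU1P[->//|xy] yd.
have xI : 0 < x < d by rewrite x0 (lt_trans xy).
have yI : 0 < y < d by rewrite yd (lt_trans x0).
have [My ey _ _ _] := inv yI; have [_ ex _ _ _] := inv xI.
by have := recip_eps_decr cl My (ltW (eta_decr xI yI xy)); rewrite ex ey.
Qed.

Lemma plog_theta_convex : cond_lam mu ->
  convex_function (`]d^-1, +oo[ : set R^o) (fun p => p * ln (theta p)).
Proof.
move=> cl; have /andP[d0 _] := dI.
have := convex_perspective d0 (log_theta_convex cl).
by under [X in convex_function _ X]eq_fun do rewrite invrK.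
Qed.

End Consequences.

Theorem theorem12p2 (R : realType) (mu : R -> R)
    (mu_moc : modulus_of_continuity mu) (mu_C2 : C2_pos mu)
    (mu_incr : forall x y, 0 <= x -> x < y -> mu x < mu y)
    (mu_osgood : osgood mu) :
  [/\ (exists2 N : set R, (\forall r \near +oo, N r) &
         strictly_concave_on N (lam mu)) <->
      (exists2 d : R, 0 < d &
         {in `]0, d[ &, {homo Afun mu : x y /~ x < y}}),
      cond_lam mu <-> cond_mu mu,
      cond_mu mu <-> cond_quot mu &
      forall N : set R, (\forall r \near +oo, N r) ->
        strictly_concave_on N (lam mu) ->
        set_inj N (eps mu) /\
        forall theta : R -> R,
          (\forall p \near +oo, {for p, continuous theta}) ->
          related theta mu ->
        forall eta : R -> R, {in N, cancel (eps mu) eta} ->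
        exists2 C0 : R, 0 < C0 &
          [/\ \forall p \near +oo, theta p = p^-1 * alpha mu eta C0 p^-1,
              (exists2 d : R, 0 < d &
                 strictly_convex_on `]0, d[ (fun e => ln (alpha mu eta C0 e))) &
              cond_lam mu ->
                (exists2 d : R, 0 < d &
                   convex_function (`]0, d[ : set R^o)
                     (fun e => ln (theta e^-1))) /\
                (exists M : R,
                   convex_function (`]M, +oo[ : set R^o)
                     (fun p => p * ln (theta p)))]].
Proof.
have mu_gt0 x : 0 < x -> 0 < mu x.
  by have [_ _ m0] := mu_moc; move=> x0; rewrite -[ltLHS]m0; exact: mu_incr.
split; [exact: strictly_concave_lam_Afun|exact: cond_lam_mu|
        exact: cond_mu_quot|].
move=> N [M [_ NM]] conc; split.
  move=> r s Nr Ns E.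
  have [rs|sr|//] := ltgtP r s.
    have := conc.2 _ _ Ns Nr rs.
    by move: E; rewrite /eps => /mulfI ->; rewrite ?ltxx.
  have := conc.2 _ _ Nr Ns sr.
  by move: E; rewrite /eps => /mulfI ->; rewrite ?ltxx.
move=> theta [P [_ ctheta]] rel eta etaK.
have [d dI inv] :=
  legendre_inversion mu_gt0 mu_C2 mu_incr mu_osgood NM conc ctheta rel etaK.
have /andP[d0 _] := dI.
have edec := eps_decr NM conc.
have epos := eps_gt0 mu_gt0 mu_C2 NM conc rel.
exists 1 => //; split.
- exists d^-1; split; first exact: num_real.
  by move=> p; exact: theta_alpha mu_gt0 rel dI inv p.
- by exists d => //; exact: log_alpha_strictly_convex edec inv.
move=> cl; split.
- exists d => //.
  exact: log_theta_convex mu_gt0 mu_C2 rel dI epos edec inv cl.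
exists d^-1.
exact: plog_theta_convex mu_gt0 mu_C2 rel dI epos edec inv cl.
Qed.
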